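(* Let $\Gamma \vdash \phi$ be an $\mathcal{L}_{\Box\Diamond}$-consecution. Then $\Gamma \vdash_{\mathsf{IM}} \phi$ if and only if $\Gamma^t \vdash_{\mathsf{IK}_2} \phi^t$.
   Context: $\mathcal{L}_{\Box\Diamond}$ is the language $\phi ::= p_i \mid \bot \mid \phi\wedge\phi \mid \phi\vee\phi \mid \phi\to\phi \mid \Box\phi \mid \Diamond\phi$. $\mathsf{IM}$ is the set of consecutions $\Gamma\vdash\phi$ such that the standard translations satisfy $\mathrm{st}_x(\Gamma)\models\mathrm{st}_x(\phi)$ in intuitionistic two-sorted first-order logic with sorts for worlds and neighbourhoods and predicates $\mathsf{N}$, $\mathsf{E}$, $\mathsf{P}_i$, where $\mathrm{st}_x(\Box\phi) = \exists a(x\mathsf{N}a \wedge \forall y(a\mathsf{E}y \to \mathrm{st}_y(\phi)))$ and $\mathrm{st}_x(\Diamond\phi) = \forall a(x\mathsf{N}a \to \exists y(a\mathsf{E}y\wedge \mathrm{st}_y(\phi)))$; equivalently, $\mathsf{IM}$ is axiomatised by intuitionistic logic plus $(\Box p\wedge\Diamond\neg p)\to\bot$ and $(\Box\top\to\Diamond p)\to\Diamond p$ with modus ponens and the monotonicity rules for $\Box$ and $\Diamond$. $\mathsf{IK}_2$ is the bimodal version (modalities $\Box_N,\Diamond_N,\Box_{\ni},\Diamond_{\ni}$) of Fischer Servi/Simpson's intuitionistic modal logic $\mathsf{IK}$: intuitionistic logic plus, for each index $j$, $\Box_j(p\to q)\to(\Box_jp\to\Box_jq)$, $\Box_j(p\to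 q)\to(\Diamond_jp\to\Diamond_jq)$, $\neg\Diamond_j\bot$, $\Diamond_j(p\vee q)\to(\Diamond_jp\vee\Diamond_jq)$, $(\Diamond_jp\to\Box_jq)\to\Box_j(p\to q)$, with modus ponens and necessitation (from $\emptyset\vdash\phi$ infer $\Gamma\vdash\Box_j\phi$). The translation $(-)^t:\mathcal{L}_{\Box\Diamond}\to\mathcal{L}_2$ fixes propositional letters and $\bot$, commutes with $\wedge,\vee,\to$, and sets $(\Box\phi)^t = \Diamond_N\Box_{\ni}\phi^t$, $(\Diamond\phi)^t = \Box_N\Diamond_{\ni}\phi^t$; $\Gamma^t = \{\psi^t \mid \psi\in\Gamma\}$. *)

(* Defs.v *)
From Stdlib Require Import Arith Ensembles Image Relation_Definitions.

(** * The language with monotone modalities *)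

Inductive form : Type :=
| Var : nat -> form
| Bot : form
| And : form -> form -> form
| Or : form -> form -> form
| Imp : form -> form -> form
| Box : form -> form
| Dia : form -> form.

(** * Two-sorted intuitionistic first-order logic *)

(* Each sort has its own supply of variables, both named by natural numbers:
   [x], [y] below are world variables and [a] is a neighbourhood variable. *)
Inductive fo : Type :=
| FoP (i x : nat)
| FoN (x a : nat)
| FoE (a y : nat)
| FoBot
| FoAnd (A B : fo)
| FoOr (A B : fo)
| FoImp (A B : fo)
| FoAllW (x : nat) (A : fo)
| FoExW (x : nat) (A : fo)
| FoAllN (a : nat) (A : fo)
| FoExN (a : nat) (A : fo).

(* Kripke structures with increasing inhabited domains.  The domains at all
   nodes are subsets of a fixed carrier for each sort; the values of the
   predicates at a node outside the domains at that node are never used by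
   [forces] below. *)
Record kripke_structure : Type := {
  node : Type;
  node_le : relation node;
  node_le_order : order node node_le;
  carrierW : Type;
  carrierN : Type;
  domW : node -> carrierW -> Prop;
  domN : node -> carrierN -> Prop;
  domW_inhabited : forall k, exists u, domW k u;
  domN_inhabited : forall k, exists n, domN k n;
  domW_mono : forall k l u, node_le k l -> domW k u -> domW l u;
  domN_mono : forall k l n, node_le k l -> domN k n -> domN l n;
  intP : node -> nat -> carrierW -> Prop;
  intN : node -> carrierW -> carrierN -> Prop;
  intE : node -> carrierN -> carrierW -> Prop;
  intP_mono : forall k l i u, node_le k l -> intP k i u -> intP l i u;
  intN_mono : forall k l u n, node_le k l -> intN k u n -> intN l u n;
  intE_mono : forall k l n u, node_le k l -> intE k n u -> intE l n u
}.

Definition update {T : Type} (e : nat -> T) (x : nat) (u : T) : nat -> T :=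
  fun z => if Nat.eqb z x then u else e z.

Fixpoint forces (M : kripke_structure) (k : node M)
    (e : nat -> carrierW M) (d : nat -> carrierN M) (A : fo) {struct A} : Prop :=
  match A with
  | FoP i x => intP M k i (e x)
  | FoN x a => intN M k (e x) (d a)
  | FoE a y => intE M k (d a) (e y)
  | FoBot => False
  | FoAnd B C => forces M k e d B /\ forces M k e d C
  | FoOr B C => forces M k e d B \/ forces M k e d C
  | FoImp B C => forall l, node_le M k l -> forces M l e d B -> forces M l e d C
  | FoAllW x B => forall l, node_le M k l ->
      forall u, domW M l u -> forces M l (update e x u) d B
  | FoExW x B => exists u, domW M k u /\ forces M k (update e x u) d B
  | FoAllN a B => forall l, node_le M k l ->
      forall n, domN M l n -> forces M l e (update d a n) B
  | FoExN a B => exists n, domN M k n /\ forces M k e (update d a n) B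
  end.

Definition fo_entails (Delta : Ensemble fo) (A : fo) : Prop :=
  forall (M : kripke_structure) (k : node M)
         (e : nat -> carrierW M) (d : nat -> carrierN M),
    (forall x, domW M k (e x)) ->
    (forall a, domN M k (d a)) ->
    (forall B, In fo Delta B -> forces M k e d B) ->
    forces M k e d A.

(** * The logic IM *)

(* The bound neighbourhood variable carries the same number as [x] but is of
   the other sort; [S x] serves as [y].  The only free variable of [st x A] is
   the world variable [x], so no capture can occur. *)
Fixpoint st (x : nat) (A : form) : fo :=
  match A with
  | Var i => FoP i x
  | Bot => FoBot
  | And B C => FoAnd (st x B) (st x C)
  | Or B C => FoOr (st x B) (st x C)
  | Imp B C => FoImp (st x B) (st x C)
  | Box B =>
      FoExN x (FoAnd (FoN x x) (FoAllW (S x) (FoImp (FoE x (S x)) (st (S x) B))))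
  | Dia B =>
      FoAllN x (FoImp (FoN x x) (FoExW (S x) (FoAnd (FoE x (S x)) (st (S x) B))))
  end.

(* World variable [0] plays the role of the fixed variable in [st]. *)
Definition IM (Gamma : Ensemble form) (phi : form) : Prop :=
  fo_entails (Im form fo Gamma (st 0)) (st 0 phi).

(** * The bimodal logic IK_2 *)

Inductive index : Type := iN | iNi.

Inductive form2 : Type :=
| Var2 : nat -> form2
| Bot2 : form2
| And2 : form2 -> form2 -> form2
| Or2 : form2 -> form2 -> form2
| Imp2 : form2 -> form2 -> form2
| Box2 : index -> form2 -> form2
| Dia2 : index -> form2 -> form2.

Declare Scope form2_scope.
Delimit Scope form2_scope with form2.
Bind Scope form2_scope with form2.
Infix "&&" := And2 : form2_scope.
Infix "||" := Or2 : form2_scope.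
Notation "A ~> B" := (Imp2 A B) (at level 55, right associativity) : form2_scope.

(* Axiom schemes, i.e. the set of axioms is closed under substitution. *)
Inductive IK2_axiom : form2 -> Prop :=
| ax_weak p q : IK2_axiom (p ~> q ~> p)
| ax_frege p q r : IK2_axiom ((p ~> q ~> r) ~> (p ~> q) ~> p ~> r)
| ax_andE1 p q : IK2_axiom ((p && q) ~> p)
| ax_andE2 p q : IK2_axiom ((p && q) ~> q)
| ax_andI p q : IK2_axiom (p ~> q ~> (p && q))
| ax_orI1 p q : IK2_axiom (p ~> (p || q))
| ax_orI2 p q : IK2_axiom (q ~> (p || q))
| ax_orE p q r : IK2_axiom ((p ~> r) ~> (q ~> r) ~> (p || q) ~> r)
| ax_efq p : IK2_axiom (Bot2 ~> p)
| ax_boxK j p q : IK2_axiom (Box2 j (p ~> q) ~> Box2 j p ~> Box2 j q)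
| ax_diaK j p q : IK2_axiom (Box2 j (p ~> q) ~> Dia2 j p ~> Dia2 j q)
| ax_dia_bot j : IK2_axiom (Dia2 j Bot2 ~> Bot2)
| ax_dia_or j p q : IK2_axiom (Dia2 j (p || q) ~> (Dia2 j p || Dia2 j q))
| ax_FS j p q : IK2_axiom ((Dia2 j p ~> Box2 j q) ~> Box2 j (p ~> q)).

Inductive IK2 : Ensemble form2 -> form2 -> Prop :=
| IK2_el Gamma p : In form2 Gamma p -> IK2 Gamma p
| IK2_ax Gamma p : IK2_axiom p -> IK2 Gamma p
| IK2_mp Gamma p q : IK2 Gamma (p ~> q) -> IK2 Gamma p -> IK2 Gamma q
| IK2_nec Gamma j p : IK2 (Empty_set form2) p -> IK2 Gamma (Box2 j p).

(** * The translation *)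

Fixpoint trans (A : form) : form2 :=
  match A with
  | Var i => Var2 i
  | Bot => Bot2
  | And B C => And2 (trans B) (trans C)
  | Or B C => Or2 (trans B) (trans C)
  | Imp B C => Imp2 (trans B) (trans C)
  | Box B => Dia2 iN (Box2 iNi (trans B))
  | Dia B => Box2 iN (Dia2 iNi (trans B))
  end.

(* Main.v *)
Require Import Defs.
From Stdlib Require Import Ensembles Image.
From Stdlib Require Import Arith Cantor Lia Relation_Definitions.
From Stdlib Require Import Classical ClassicalEpsilon.
From Stdlib Require Import FunctionalExtensionality PropExtensionality.

(** From right to left, a two-sorted Kripke structure is read as a one-sorted
    one whose points are the worlds and the neighbourhoods together; [IK2] is
    sound there, and the standard translation factors through [trans].

    From left to right, consider the consequence relation
    [Gamma^t |-_IK2 phi^t] on monotone formulas.  It is intuitionistic and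
    finitary, both modalities are monotone, [Box p] and [Dia q] are incompatible
    whenever [p] and [q] are, and [(Box T -> Dia p) -> Dia p] holds.  These
    properties suffice for a canonical two-sorted structure.  Its nodes assign
    prime theories to names of worlds and are ordered by pointwise inclusion;
    worlds evolve independently of each other.  At every node each prime theory
    is the theory of some name, and a clock gives every node a proper
    successor.  The neighbourhoods are the extensions of the formulas [p]
    (neighbourhoods of the worlds where [Box p] holds), and, for each node [l],
    world [x] and formula [q] with [Box T] but not [Dia q] in the theory of [x]
    at [l], one neighbourhood of [x] which at [l] consists of the worlds omitting
    [q] and contains every world at all nodes properly above [l]. *)

(** * Soundness of [IK2] in two-sorted structures *)

Section Soundness.
Variable M : kripke_structure.

Definition point : Type := (carrierW M + carrierN M)%type.

Definition domP (k : node M) (s : point) : Prop :=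
  match s with inl u => domW M k u | inr n => domN M k n end.

Definition rel (j : index) (k : node M) (s s' : point) : Prop :=
  match j, s, s' with
  | iN, inl u, inr n => intN M k u n
  | iNi, inr n, inl u => intE M k n u
  | _, _, _ => False
  end.

Fixpoint sat (k : node M) (s : point) (A : form2) : Prop :=
  match A with
  | Var2 i => match s with inl u => intP M k i u | inr _ => False end
  | Bot2 => False
  | And2 B C => sat k s B /\ sat k s C
  | Or2 B C => sat k s B \/ sat k s C
  | Imp2 B C => forall l, node_le M k l -> sat l s B -> sat l s C
  | Box2 j B => forall l, node_le M k l ->
      forall s', domP l s' -> rel j l s s' -> sat l s' B
  | Dia2 j B => exists s', domP k s' /\ rel j k s s' /\ sat k s' B
  end.

Lemma node_le_refl (k : node M) : node_le M k k.
Proof. exact (ord_refl _ _ (node_le_order M) k). Qed.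

Lemma node_le_trans (k l m : node M) :
  node_le M k l -> node_le M l m -> node_le M k m.
Proof. exact (ord_trans _ _ (node_le_order M) k l m). Qed.

Lemma domP_mono k l s : node_le M k l -> domP k s -> domP l s.
Proof. destruct s; [apply domW_mono | apply domN_mono]. Qed.

Lemma rel_mono j k l s s' : node_le M k l -> rel j k s s' -> rel j l s s'.
Proof.
  destruct j, s, s'; simpl; auto; [apply intN_mono | apply intE_mono].
Qed.

Lemma sat_mono A : forall k l s, node_le M k l -> sat k s A -> sat l s A.
Proof.
  induction A; simpl; intros k l s Hkl H; auto.
  - destruct s; auto. eapply intP_mono; eauto.
  - destruct H; split; eauto.
  - destruct H; eauto.
  - intros m Hm. apply H. eauto using node_le_trans.
  - intros m Hm. apply H. eauto using node_le_trans.
  - destruct H as (s' & Hd & HR & H).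
    exists s'. split; [|split].
    + exact (domP_mono k l s' Hkl Hd).
    + exact (rel_mono i k l s s' Hkl HR).
    + exact (IHA k l s' Hkl H).
Qed.

Lemma IK2_axiom_sound A : IK2_axiom A -> forall k s, sat k s A.
Proof.
  intros H; destruct H; intros k s; simpl.
  - intros l _ Hp m Hm _. eauto using sat_mono.
  - intros l _ H m Hm Hpq n Hn Hp.
    apply (H n (node_le_trans _ _ _ Hm Hn) Hp n (node_le_refl n)). auto.
  - tauto.
  - tauto.
  - intros l _ Hp m Hm Hq. eauto using sat_mono.
  - auto.
  - auto.
  - intros l _ Hp m Hm Hq n Hn [H|H]; eauto using node_le_trans.
  - tauto.
  - intros l _ H m Hm Hp n Hn s' Hd HR.
    apply (H n (node_le_trans _ _ _ Hm Hn) s' Hd HR n (node_le_refl n)). auto.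
  - intros l _ H m Hm (s' & Hd & HR & Hp).
    exists s'. split; [|split]; auto.
    exact (H m Hm s' Hd HR m (node_le_refl m) Hp).
  - intros l _ (s' & _ & _ & []).
  - intros l _ (s' & Hd & HR & [H|H]);
      [left|right]; exists s'; auto.
  (* The Fischer Servi axiom: the point [s'] reached at [m] stays in the domain and accessible at
     every later [n], so there it witnesses the diamond and receives the conclusion of the box. *)
  - intros l _ H m Hm s' Hd HR n Hn Hp.
    apply (H n (node_le_trans _ _ _ Hm Hn)) with (l := n).
    + exists s'. split; [|split]; auto.
      * exact (domP_mono m n s' Hn Hd).
      * exact (rel_mono j m n s s' Hn HR).
    + apply node_le_refl.
    + exact (domP_mono m n s' Hn Hd).
    + exact (rel_mono j m n s s' Hn HR).
Qed.

Lemma IK2_sound Gamma A : IK2 Gamma A ->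
  forall k s, (forall B, In _ Gamma B -> sat k s B) -> sat k s A.
Proof.
  intros H; induction H; intros k s Hs.
  - auto.
  - auto using IK2_axiom_sound.
  - exact (IHIK2_1 k s Hs k (node_le_refl k) (IHIK2_2 k s Hs)).
  - intros l _ s' _ _. apply IHIK2. intros B [].
Qed.

Lemma update_eq {T} (e : nat -> T) x u : update e x u x = u.
Proof. unfold update. now rewrite Nat.eqb_refl. Qed.

(** A guarded universal quantifier in [st] moves to later nodes twice, for the quantifier and for
    the implication; reflexivity and transitivity collapse this to the single move in [sat]. *)
Lemma forces_st A : forall x k e d,
  forces M k e d (st x A) <-> sat k (inl (e x)) (trans A).
Proof.
  induction A; intros x k e d; cbn -[update].
  - tauto.
  - tauto.
  - now rewrite IHA1, IHA2.
  - now rewrite IHA1, IHA2.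
  - split; intros H l Hl H1; apply (IHA2 x l e d), (H l Hl);
      now apply (IHA1 x l e d).
  - split.
    + intros (n & Hn & HN & H). rewrite update_eq in HN. exists (inr n). split; [|split]; auto.
      intros l Hl [u|n'] Hd HR; [|contradiction].
      specialize (H l Hl u Hd l (node_le_refl l)).
      rewrite IHA, !update_eq in H. auto.
    + intros ([u|n] & Hn & HN & H); [contradiction|].
      exists n. rewrite update_eq. split; [|split]; auto.
      intros l Hl u Hu m Hm. rewrite IHA, !update_eq. intros HE.
      apply H; eauto using node_le_trans. eapply domW_mono; eauto.
  - split.
    + intros H l Hl [u|n] Hd HR; [contradiction|].
      specialize (H l Hl n Hd l (node_le_refl l)).
      rewrite update_eq in H.
      destruct (H HR) as (u & Hu & HE & Hf).
      rewrite IHA, update_eq in Hf. rewrite update_eq in HE.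
      exists (inl u). auto.
    + intros H l Hl n Hn m Hm. rewrite update_eq. intros HN.
      destruct (H m (node_le_trans _ _ _ Hl Hm) (inr n)) as
        ([u|n'] & Hu & HE & Hf); simpl; auto.
      * eapply domN_mono; eauto.
      * exists u. rewrite IHA, !update_eq. auto.
      * contradiction.
Qed.

End Soundness.

Lemma IK2_IM Gamma phi :
  IK2 (Im form form2 Gamma trans) (trans phi) -> IM Gamma phi.
Proof.
  intros H M k e d _ _ HG. apply forces_st.
  apply (IK2_sound M _ _ H). intros _ [A HA _ ->].
  apply (forces_st M A 0 k e d). apply HG. now exists A.
Qed.

(** * Derivations in [IK2] *)

Lemma IK2_weaken Gamma A :
  IK2 Gamma A -> forall Delta, Included _ Gamma Delta -> IK2 Delta A.
Proof.
  intros H; induction H; intros Delta HD.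
  - apply IK2_el; auto.
  - apply IK2_ax; auto.
  - eapply IK2_mp; eauto.
  - apply IK2_nec; auto.
Qed.

Lemma IK2_id Gamma A : IK2 Gamma (A ~> A)%form2.
Proof.
  eapply IK2_mp; [eapply IK2_mp|]; apply IK2_ax.
  - exact (ax_frege A (A ~> A)%form2 A).
  - apply ax_weak.
  - apply ax_weak.
Qed.

Lemma IK2_const Gamma A B : IK2 Gamma B -> IK2 Gamma (A ~> B)%form2.
Proof. intros H. eapply IK2_mp; [apply IK2_ax, ax_weak|exact H]. Qed.

Lemma IK2_deduction Gamma A B :
  IK2 (Add _ Gamma A) B -> IK2 Gamma (A ~> B)%form2.
Proof.
  intros H. remember (Add _ Gamma A) as Delta eqn:E.
  revert Gamma E. induction H as [D p Hp|D p Hp|D p q H1 IH1 H2 IH2|D j p H IH];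
    intros Gamma ->.
  - destruct Hp as [p Hp|p []].
    + now apply IK2_const, IK2_el.
    + apply IK2_id.
  - now apply IK2_const, IK2_ax.
  - eapply IK2_mp; [eapply IK2_mp; [apply IK2_ax, ax_frege|]|]; eauto.
  - now apply IK2_const, IK2_nec.
Qed.

Lemma IK2_box_mono Gamma j A B :
  IK2 (Empty_set _) (A ~> B)%form2 -> IK2 Gamma (Box2 j A ~> Box2 j B)%form2.
Proof.
  intros H. eapply IK2_mp; [apply IK2_ax, ax_boxK|]. now apply IK2_nec.
Qed.

Lemma IK2_dia_mono Gamma j A B :
  IK2 (Empty_set _) (A ~> B)%form2 -> IK2 Gamma (Dia2 j A ~> Dia2 j B)%form2.
Proof.
  intros H. eapply IK2_mp; [apply IK2_ax, ax_diaK|]. now apply IK2_nec.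
Qed.

Lemma IK2_box_dia_bot Gamma j A B :
  IK2 (Empty_set _) (A ~> B ~> Bot2)%form2 ->
  IK2 Gamma (Box2 j A ~> Dia2 j B ~> Bot2)%form2.
Proof.
  intros H. apply IK2_deduction, IK2_deduction.
  eapply IK2_mp; [apply IK2_ax, (ax_dia_bot j)|].
  eapply IK2_mp; [eapply IK2_mp; [apply IK2_ax, ax_diaK|]|].
  - eapply IK2_mp; [exact (IK2_box_mono _ j _ _ H)|].
    apply IK2_el. left. now right.
  - apply IK2_el. now right.
Qed.

(** * The consequence relation induced by the translation *)

Definition der (Gamma : Ensemble form) (A : form) : Prop :=
  IK2 (Im form form2 Gamma trans) (trans A).

Definition Top : form := Imp Bot Bot.

Lemma der_el (Gamma : Ensemble form) A : Gamma A -> der Gamma A.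
Proof. intros H. apply IK2_el. now exists A. Qed.

Lemma der_mp Gamma A B : der Gamma (Imp A B) -> der Gamma A -> der Gamma B.
Proof. apply IK2_mp. Qed.

Lemma der_weaken Gamma Delta A :
  der Gamma A -> Included _ Gamma Delta -> der Delta A.
Proof.
  intros H HG. eapply IK2_weaken; [exact H|].
  intros _ [B HB _ ->]. exists B; auto.
Qed.

Lemma der_deduction Gamma A B : der (Add _ Gamma A) B -> der Gamma (Imp A B).
Proof.
  intros H. apply IK2_deduction. eapply IK2_weaken; [exact H|].
  intros _ [C [D HD|D []] _ ->].
  - left. now exists D.
  - now right.
Qed.

Lemma IK2_of_der A B : der (Singleton _ A) B ->
  IK2 (Empty_set _) (trans A ~> trans B)%form2.
Proof.
  intros H. apply IK2_deduction. eapply IK2_weaken; [exact H|].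
  intros _ [C [] _ ->]. now right.
Qed.

Lemma der_box_mono A B Gamma :
  der (Singleton _ A) B -> der Gamma (Imp (Box A) (Box B)).
Proof. intros H. apply IK2_dia_mono, IK2_box_mono, IK2_of_der, H. Qed.

Lemma der_dia_mono A B Gamma :
  der (Singleton _ A) B -> der Gamma (Imp (Dia A) (Dia B)).
Proof. intros H. apply IK2_box_mono, IK2_dia_mono, IK2_of_der, H. Qed.

(** The inner modalities already clash, so [Box2 iN (Dia2 iNi (trans B))] gives
    [Box2 iN (Box2 iNi (trans A) ~> Bot2)]; against the outer diamond of [Box A] this yields
    [Dia2 iN Bot2]. *)
Lemma der_box_dia_bot A B Gamma :
  der (Couple _ A B) Bot -> der Gamma (Imp (Box A) (Imp (Dia B) Bot)).
Proof.
  intros H. unfold der; simpl.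
  assert (HAB : IK2 (Empty_set _) (trans A ~> trans B ~> Bot2)%form2).
  { apply IK2_deduction, IK2_deduction. eapply IK2_weaken; [exact H|].
    intros _ [C [] _ ->]; [left; now right|now right]. }
  apply IK2_deduction, IK2_deduction.
  eapply IK2_mp; [|apply IK2_el; now right].
  eapply IK2_weaken; [|intros x Hx; left; exact Hx].
  apply IK2_deduction.
  eapply IK2_mp; [apply IK2_ax, (ax_dia_bot iN)|].
  eapply IK2_mp; [eapply IK2_mp; [apply IK2_ax, ax_diaK|]|].
  - eapply IK2_mp; [apply (IK2_box_mono _ iN (Dia2 iNi (trans B)))|apply IK2_el; now right].
    apply IK2_deduction, IK2_deduction.
    eapply IK2_mp; [eapply IK2_mp; [apply IK2_box_dia_bot, HAB|]|].
    + apply IK2_el. now right.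
    + apply IK2_el. left. now right.
  - apply IK2_el. left. now right.
Qed.

(** The premise translates to an instance of the antecedent of the Fischer Servi axiom. Under the
    resulting [Box2 iN], the hypothesis coming from [Top] is a necessitated theorem and can be
    discharged. *)
Lemma der_dia_top A Gamma :
  der Gamma (Imp (Imp (Box Top) (Dia A)) (Dia A)).
Proof.
  unfold der; simpl. apply IK2_deduction.
  eapply IK2_mp.
  - apply (IK2_box_mono _ iN (Box2 iNi (Bot2 ~> Bot2) ~> Dia2 iNi (trans A))%form2).
    apply IK2_deduction. eapply IK2_mp; [apply IK2_el; now right|].
    apply IK2_nec, IK2_id.
  - eapply IK2_mp; [apply IK2_ax, ax_FS|]. apply IK2_el. now right.
Qed.

(** Only modus ponens merges two contexts, and along a chain the larger index serves both
    premises. *)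
Lemma der_union (G : nat -> Ensemble form) A :
  (forall m n, m <= n -> Included _ (G m) (G n)) ->
  der (fun B => exists n, G n B) A -> exists n, der (G n) A.
Proof.
  intros HG H. unfold der in *.
  remember (Im form form2 (fun B => exists n, G n B) trans) as D eqn:E.
  induction H as [D p Hp|D p Hp|D p q H1 IH1 H2 IH2|D j p H IH]; subst D.
  - destruct Hp as [B [n Hn] _ ->]. exists n. apply IK2_el. now exists B.
  - exists 0. now apply IK2_ax.
  - destruct (IH1 eq_refl) as [m Hm], (IH2 eq_refl) as [n Hn].
    exists (Nat.max m n). eapply IK2_mp.
    + eapply IK2_weaken; [exact Hm|]. intros _ [C HC _ ->]. exists C; auto.
      apply (HG m); [lia|exact HC].
    + eapply IK2_weaken; [exact Hn|]. intros _ [C HC _ ->]. exists C; auto.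
      apply (HG n); [lia|exact HC].
  - exists 0. now apply IK2_nec.
Qed.

(** * Prime theories *)

Record prime (t : form -> Prop) : Prop := {
  prime_closed : forall A, der t A -> t A;
  prime_consistent : ~ t Bot;
  prime_or : forall A B, t (Or A B) -> t A \/ t B
}.

Fixpoint code (A : form) : nat :=
  match A with
  | Var i => to_nat (0, i)
  | Bot => to_nat (1, 0)
  | And B C => to_nat (2, to_nat (code B, code C))
  | Or B C => to_nat (3, to_nat (code B, code C))
  | Imp B C => to_nat (4, to_nat (code B, code C))
  | Box B => to_nat (5, code B)
  | Dia B => to_nat (6, code B)
  end.

Lemma code_inj A : forall B, code A = code B -> A = B.
Proof.
  induction A; intros [] H; cbn [code] in H;
    apply to_nat_inj, pair_equal_spec in H as [Htag H]; try discriminate Htag;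
    try (apply to_nat_inj, pair_equal_spec in H as [H1 H2]); f_equal; auto.
Qed.

Section Lindenbaum.
Variables (Gamma : Ensemble form) (phi : form).

Fixpoint stage (n : nat) : Ensemble form :=
  match n with
  | 0 => Gamma
  | S n => fun A => stage n A \/
                    (code A = n /\ ~ der (Add _ (stage n) A) phi)
  end.

Lemma stage_mono m n : m <= n -> Included _ (stage m) (stage n).
Proof.
  induction 1; intros A HA; [exact HA|]. left. now apply IHle.
Qed.

(** Injectivity of [code] lets at most one formula enter at each stage, and the guard in [stage] is
    exactly that adding it does not derive [phi]. *)
Lemma stage_unprovable n : ~ der Gamma phi -> ~ der (stage n) phi.
Proof.
  intros H0. induction n as [|n IH]; [exact H0|]. intros H.
  destruct (classic (exists A, code A = n /\ ~ der (Add _ (stage n) A) phi))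
    as [(A & HA & HnA)|HN].
  - apply HnA. eapply der_weaken; [exact H|].
    intros B [HB|[HB _]]; [now left|].
    rewrite (code_inj B A) by congruence. now right.
  - apply IH. eapply der_weaken; [exact H|].
    intros B [HB|HB]; [exact HB|]. exfalso. eauto.
Qed.

Lemma lindenbaum : ~ der Gamma phi ->
  exists t, prime t /\ (forall A, Gamma A -> t A) /\ ~ t phi.
Proof.
  intros H0. set (t := fun A => exists n, stage n A).
  assert (Hphi : ~ der t phi).
  { intros H. apply der_union in H; [|exact stage_mono].
    destruct H as [n Hn]. exact (stage_unprovable n H0 Hn). }
  (* An omitted formula was rejected at the stage of its own code, hence implies [phi] over that
     stage. Closure and primality of [t] both rest on this. *)
  assert (Hmax : forall A, ~ t A -> der t (Imp A phi)).
  { intros A HA. apply (der_weaken (stage (code A))).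
    - apply der_deduction. apply NNPP. intros HN. apply HA.
      exists (S (code A)). now right.
    - intros B HB. now exists (code A). }
  exists t. split; [split|split].
  - intros A HA. apply NNPP. intros HN. apply Hphi.
    exact (der_mp _ _ _ (Hmax A HN) HA).
  - intros HB. apply Hphi. eapply der_mp; [|exact (der_el _ _ HB)].
    apply IK2_ax, ax_efq.
  - intros A B HAB. apply NNPP. intros HN. apply Hphi.
    eapply der_mp; [|exact (der_el _ _ HAB)].
    apply (der_mp _ (Imp B phi)); [apply (der_mp _ (Imp A phi))|].
    + apply IK2_ax, ax_orE.
    + apply Hmax. tauto.
    + apply Hmax. tauto.
  - intros A HA. now exists 0.
  - intros H. now apply Hphi, der_el.
Qed.

End Lindenbaum.

Definition theory : Type := {t : form -> Prop | prime t}.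

Definition mem (t : theory) (A : form) : Prop := proj1_sig t A.

Lemma exists_theory Gamma A : ~ der Gamma A ->
  exists t : theory, (forall B, In _ Gamma B -> mem t B) /\ ~ mem t A.
Proof.
  intros H. destruct (lindenbaum Gamma A H) as (t & Ht & H1).
  now exists (exist _ t Ht).
Qed.

Lemma mem_closed (t : theory) A : der (mem t) A -> mem t A.
Proof. apply (prime_closed _ (proj2_sig t)). Qed.

Lemma mem_mp (t : theory) A B : der (mem t) (Imp A B) -> mem t A -> mem t B.
Proof. intros HAB HA. apply mem_closed. eapply der_mp; eauto using der_el. Qed.

Lemma mem_bot (t : theory) : ~ mem t Bot.
Proof. apply (prime_consistent _ (proj2_sig t)). Qed.

Lemma mem_and (t : theory) A B : mem t (And A B) <-> mem t A /\ mem t B.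
Proof.
  split.
  - intros H; split; (eapply mem_mp; [|exact H]); apply IK2_ax;
      [apply ax_andE1|apply ax_andE2].
  - intros [HA HB]. eapply mem_mp; [|exact HB].
    eapply der_mp; [|exact (der_el _ _ HA)]. apply IK2_ax, ax_andI.
Qed.

Lemma mem_or (t : theory) A B : mem t (Or A B) <-> mem t A \/ mem t B.
Proof.
  split.
  - apply (prime_or _ (proj2_sig t)).
  - intros [H|H]; (eapply mem_mp; [|exact H]); apply IK2_ax;
      [apply ax_orI1|apply ax_orI2].
Qed.

Lemma not_mem_imp (t : theory) A B : ~ mem t (Imp A B) ->
  exists t' : theory, (forall C, mem t C -> mem t' C) /\ mem t' A /\ ~ mem t' B.
Proof.
  intros H. destruct (exists_theory (Add _ (mem t) A) B) as (t' & H1 & H2).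
  - intros HD. now apply H, mem_closed, der_deduction.
  - exists t'. split; [|split]; auto.
    + intros C HC. apply H1. now left.
    + apply H1. now right.
Qed.

Lemma mem_box_dia (t : theory) A B : mem t (Box A) -> mem t (Dia B) ->
  exists t' : theory, mem t' A /\ mem t' B.
Proof.
  intros HA HB. destruct (exists_theory (Couple _ A B) Bot) as (t' & H1 & _).
  - intros HD. apply (mem_bot t). eapply mem_mp; [|exact HB].
    eapply der_mp; [|exact (der_el _ _ HA)]. now apply der_box_dia_bot.
  - exists t'. split; apply H1; constructor.
Qed.

(** * The canonical structure *)

Definition name : Type := (theory * nat)%type.

(* [th_fresh]: only boundedly many copies of each theory have been promoted, so
   that an untouched copy always remains. *)
Record cnode : Type := {
  th : name -> theory;
  clock : nat;
  th_fresh : exists m, forall t n, m <= n -> th (t, n) = t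
}.

Definition cle (k l : cnode) : Prop :=
  clock k <= clock l /\ forall x A, mem (th k x) A -> mem (th l x) A.

Lemma cle_refl k : cle k k.
Proof. split; auto. Qed.

Lemma cle_trans k l m : cle k l -> cle l m -> cle k m.
Proof. intros [H1 H2] [H3 H4]. split; [lia|auto]. Qed.

(** Antisymmetry of [cle] requires equality of theories, not mere equivalence. *)
Lemma theory_ext (t t' : theory) : (forall A, mem t A <-> mem t' A) -> t = t'.
Proof.
  destruct t as [t p], t' as [t' p']; unfold mem; simpl. intros H.
  assert (t = t') as ->.
  { extensionality A. now apply propositional_extensionality. }
  f_equal. apply proof_irrelevance.
Qed.

Lemma cle_antisym k l : cle k l -> cle l k -> k = l.
Proof.
  destruct k as [f m p], l as [g n q]. intros [H1 H2] [H3 H4]; simpl in *.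
  assert (f = g) as ->.
  { extensionality x. apply theory_ext. split; auto. }
  assert (m = n) as -> by lia.
  f_equal. apply proof_irrelevance.
Qed.

Lemma cle_order : order cnode cle.
Proof.
  split; [exact cle_refl|exact cle_trans|exact cle_antisym].
Qed.

Lemma fresh_name (k : cnode) (t : theory) : exists y, th k y = t.
Proof. destruct (th_fresh k) as [m Hm]. exists (t, m). auto. Qed.

Lemma promote (k : cnode) (x : name) (t : theory) :
  (forall A, mem (th k x) A -> mem t A) -> exists l, cle k l /\ th l x = t.
Proof.
  intros Ht.
  set (f := fun y => if excluded_middle_informative (y = x) then t else th k y).
  assert (Hf : exists m, forall t n, m <= n -> f (t, n) = t).
  { destruct (th_fresh k) as [m Hm], x as [u i].
    (* The new bound also exceeds the copy number [i] of the altered name. *)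
    exists (Nat.max m (S i)). intros s n Hn. unfold f.
    destruct excluded_middle_informative as [E|_].
    - injection E. lia.
    - apply Hm. lia. }
  exists {| th := f; clock := clock k; th_fresh := Hf |}. split; [split|]; simpl.
  - auto.
  - intros y A HA. unfold f.
    destruct excluded_middle_informative as [->|]; auto.
  - unfold f. now destruct excluded_middle_informative.
Qed.

(** A proper successor with unchanged theories, at which every [Omit] neighbourhood based at or
    below [k] contains all worlds. *)
Definition tick (k : cnode) : cnode :=
  {| th := th k; clock := S (clock k); th_fresh := th_fresh k |}.

Lemma cle_tick k : cle k (tick k).
Proof. split; simpl; auto. Qed.

Inductive nbhd : Type :=
| Ext (p : form)
| Omit (l : cnode) (x : name) (q : form).

Definition cN (k : cnode) (x : name) (a : nbhd) : Prop :=
  match a with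
  | Ext p => mem (th k x) (Box p)
  | Omit l z q => x = z /\ cle l k /\
      mem (th l z) (Box Top) /\ ~ mem (th l z) (Dia q)
  end.

(** Given [cle l k], the premise [cle k l] says that [k] is [l]. Moving up can only falsify it, so
    the restriction on [q] lapses and extensions grow. *)
Definition cE (k : cnode) (a : nbhd) (y : name) : Prop :=
  match a with
  | Ext p => mem (th k y) p
  | Omit l _ q => cle l k /\ (cle k l -> ~ mem (th l y) q)
  end.

Lemma cN_mono k l x a : cle k l -> cN k x a -> cN l x a.
Proof.
  intros H; destruct a; simpl.
  - apply H.
  - intuition. eauto using cle_trans.
Qed.

Lemma cE_mono k l a y : cle k l -> cE k a y -> cE l a y.
Proof.
  intros H; destruct a; simpl.
  - apply H.
  - intros [H1 H2]. split; eauto using cle_trans.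
Qed.

Definition canonical (t0 : theory) : kripke_structure := {|
  node := cnode;
  node_le := cle;
  node_le_order := cle_order;
  carrierW := name;
  carrierN := nbhd;
  domW := fun _ _ => True;
  domN := fun _ _ => True;
  domW_inhabited := fun _ => ex_intro _ (t0, 0) I;
  domN_inhabited := fun _ => ex_intro _ (Ext Bot) I;
  domW_mono := fun _ _ _ _ H => H;
  domN_mono := fun _ _ _ _ H => H;
  intP := fun k i x => mem (th k x) (Var i);
  intN := cN;
  intE := cE;
  intP_mono := fun k l i x H => proj2 H x (Var i);
  intN_mono := cN_mono;
  intE_mono := cE_mono
|}.

(** For [Ext p'], every prime theory is named at [k], so inclusion of extensions there already makes
    [p] derivable from [p']. *)
Lemma cN_box k x a p : cN k x a ->
  (forall l y, cle k l -> cE l a y -> mem (th l y) p) -> mem (th k x) (Box p).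
Proof.
  destruct a as [p'|l z q]; simpl.
  - intros HN H. eapply mem_mp; [|exact HN]. apply der_box_mono.
    apply NNPP. intros HD. destruct (exists_theory _ _ HD) as (t & H1 & H2).
    destruct (fresh_name k t) as [y Hy].
    apply H2. rewrite <- Hy. apply H; [apply cle_refl|].
    rewrite Hy. apply H1. constructor.
  (* One tick later the neighbourhood holds every world, so [p] lies in every prime theory and is
     derivable from [Top]; monotonicity applies to [Box Top]. *)
  - intros (-> & Hlk & HT & _) H. apply Hlk in HT.
    eapply mem_mp; [|exact HT]. apply der_box_mono.
    apply NNPP. intros HD. destruct (exists_theory _ _ HD) as (t & _ & H2).
    destruct (fresh_name (tick k) t) as [y Hy].
    apply H2. rewrite <- Hy. apply H; [apply cle_tick|].
    split; [exact (cle_trans _ _ _ Hlk (cle_tick k))|].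
    intros [Hc _]. destruct Hlk as [Hc' _]. simpl in Hc. lia.
Qed.

Lemma cN_dia k x a q : cN k x a -> mem (th k x) (Dia q) ->
  exists y, cE k a y /\ mem (th k y) q.
Proof.
  destruct a as [p|l z r]; simpl.
  - intros HN HD. destruct (mem_box_dia _ _ _ HN HD) as (t & Hp & Hq).
    destruct (fresh_name k t) as [y <-]. eauto.
  - intros (-> & Hlk & HT & Hr) HD.
    destruct (classic (cle k l)) as [Hkl|Hkl].
    (* At [l] a world with [q] but without [r] is needed: if [q] derived [r], then [Dia q] would
       give [Dia r], which [Omit] excludes. *)
    + assert (k = l) as -> by now apply cle_antisym.
      destruct (exists_theory (Singleton _ q) r) as (t & H1 & H2).
      { intros H. apply Hr. eapply mem_mp; [|exact HD]. now apply der_dia_mono. }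
      destruct (fresh_name l t) as [y <-]. exists y. split; [auto|].
      apply H1. constructor.
    (* Strictly above [l] every world belongs, and [Box Top] with [Dia q] provides a prime theory
       containing [q]. *)
    + apply Hlk in HT. destruct (mem_box_dia _ _ _ HT HD) as (t & _ & Hq).
      destruct (fresh_name k t) as [y <-]. exists y. tauto.
Qed.

(** By [der_dia_top] the theory also lacks [Imp (Box Top) (Dia q)], so [x] can be promoted to
    contain [Box Top] and still omit [Dia q]; at that node an [Omit] neighbourhood is available. *)
Lemma not_mem_dia k x q : ~ mem (th k x) (Dia q) ->
  exists l a, cle k l /\ cN l x a /\ forall y, cE l a y -> ~ mem (th l y) q.
Proof.
  intros H. destruct (not_mem_imp (th k x) (Box Top) (Dia q)) as (t & H1 & HT & Hq).
  - intros H'. apply H. eapply mem_mp; [apply der_dia_top|exact H'].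
  - destruct (promote k x t H1) as (l & Hkl & <-).
    exists l, (Omit l x q). split; [exact Hkl|]. split.
    + split; auto using cle_refl.
    + intros y [_ Hy]. apply Hy, cle_refl.
Qed.

Lemma truth t0 A : forall x k e d,
  forces (canonical t0) k e d (st x A) <-> mem (th k (e x)) A.
Proof.
  induction A; intros x k e d; cbn -[update].
  - tauto.
  - split; [tauto|apply mem_bot].
  - now rewrite IHA1, IHA2, mem_and.
  - now rewrite IHA1, IHA2, mem_or.
  - split.
    + intros H. apply NNPP. intros HN.
      destruct (not_mem_imp _ _ _ HN) as (t & H1 & H2 & H3).
      (* Any prime extension of the theory of one world is realised at a later node, with no
         compatibility condition on other worlds. *)
      destruct (promote k (e x) t H1) as (l & Hkl & <-).
      apply H3. apply IHA2 with d. apply H; auto. now apply IHA1.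
    + intros H l Hl HA. apply IHA2. apply IHA1 in HA.
      apply Hl in H. eapply mem_mp; [|exact HA]. now apply der_el.
  - split.
    + intros (a & _ & HN & H). rewrite update_eq in HN.
      apply (cN_box _ _ _ _ HN). intros l y Hl HE.
      specialize (H l Hl y I l (cle_refl l)).
      rewrite IHA, !update_eq in H. auto.
    + intros H. exists (Ext A). rewrite update_eq. split; [|split]; auto.
      intros l _ y _ m _. rewrite IHA, !update_eq. auto.
  - split.
    + intros H. apply NNPP. intros HN.
      destruct (not_mem_dia _ _ _ HN) as (l & a & Hl & HNa & Hq).
      specialize (H l Hl a I l (cle_refl l)). rewrite update_eq in H.
      destruct (H HNa) as (y & _ & HE & Hy).
      rewrite IHA, update_eq in Hy. rewrite update_eq in HE.
      exact (Hq y HE Hy).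
    + intros H l Hl a _ m Hm. rewrite update_eq. intros HN.
      destruct (cN_dia _ _ _ A HN) as (y & HE & Hy).
      * now apply Hm, Hl.
      * exists y. rewrite IHA, !update_eq. auto.
Qed.

Lemma IM_IK2 Gamma phi :
  IM Gamma phi -> IK2 (Im form form2 Gamma trans) (trans phi).
Proof.
  intros H. apply NNPP. intros HN.
  destruct (exists_theory Gamma phi HN) as (t & H1 & H2).
  (* The starting node: each name carries its own theory, so [(t, 0)] is a world with theory [t]. *)
  set (k := {| th := fst; clock := 0;
               th_fresh := ex_intro _ 0 (fun (t : theory) n _ => eq_refl) |}).
  apply H2. change (mem (th k (t, 0)) phi).
  apply (truth t phi 0 k (fun _ => (t, 0)) (fun _ => Ext Bot)).
  apply (H (canonical t)); simpl; auto.
  intros _ [A HA _ ->]. apply (truth t A 0 k). now apply H1.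
Qed.

Theorem theorem4p19 (Gamma : Ensemble form) (phi : form) :
  IM Gamma phi <-> IK2 (Im form form2 Gamma trans) (trans phi).
Proof.
  split; [apply IM_IK2 | apply IK2_IM].
Qed.
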